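(* Let $R$ be a commutative integral domain with $1 \neq 0$ that is not a field. Then $R$ is semiprimitive if and only if the group of units $U(R)$ is not an open set in the Macías space $M(R)$.
   Context: For a commutative integral domain $R$ with $1 \neq 0$, write $R^0 = R \setminus \{0\}$. For $k \in R^0$ let $\sigma_k^0 := \{s \in R^0 : \langle k \rangle + \langle s \rangle = R\}$, where $\langle k \rangle$ is the principal ideal generated by $k$. The sets $\sigma_k^0$ ($k \in R^0$) form a basis of a topology on $R^0$; the Macías space $M(R)$ is the set $R^0$ with this topology. The Jacobson radical $\mathfrak{J}(R)$ is the intersection of all maximal ideals of $R$, and $R$ is semiprimitive if $\mathfrak{J}(R) = \{0\}$. *)

(* Defs.v *)
From HB Require Import structures.
From mathcomp Require Import all_boot all_order all_algebra.
From mathcomp Require Import boolp classical_sets topology.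

Set Implicit Arguments.
Unset Strict Implicit.
Unset Printing Implicit Defensive.

Import GRing.Theory.
Local Open Scope classical_set_scope.
Local Open Scope ring_scope.

Definition principal_ideal (R : idomainType) (k : R) : set R :=
  [set a * k | a in setT].

Definition ideal_add (R : idomainType) (I J : set R) : set R :=
  [set x + y | x in I & y in J].

(* [idealr_closed] already requires [1 \notin I]: it is the library's notion   *)
(* of a proper ideal.                                                         *)
Definition maximal_ideal (R : idomainType) (M : set R) : Prop :=
  idealr_closed (mem M) /\
  forall J : set R, idealr_closed (mem J) -> M `<=` J -> J = M.

Definition jacobson_radical (R : idomainType) : set R :=
  \bigcap_(M in [set M : set R | maximal_ideal M]) M.
Arguments jacobson_radical : clear implicits.

Definition semiprimitive (R : idomainType) : Prop :=
  jacobson_radical R = [set 0].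

Definition macias (R : idomainType) : Type := {x : R | x != 0}.
Arguments macias : clear implicits.

HB.instance Definition _ (R : idomainType) := SubChoice.on (macias R).
HB.instance Definition _ (R : idomainType) :=
  isPointed.Build (macias R) (Sub (1 : R) (oner_neq0 R)).

Definition sigma0 (R : idomainType) (k : macias R) : set (macias R) :=
  [set s | ideal_add (principal_ideal (val k)) (principal_ideal (val s)) = setT].

Lemma sigma0P (R : idomainType) (k s : macias R) :
  sigma0 k s <-> exists a b : R, a * val k + b * val s = 1.
Proof.
split=> [ks|[a [b ab1]]].
  have : [set: R] 1 by [].
  by rewrite -ks => -[_ [a _ <-]] [_ [b _ <-]] ab1; exists a, b.
apply/seteqP; split=> // x _; exists (x * a * val k); first by exists (x * a).
exists (x * b * val s); first by exists (x * b).
by rewrite -!mulrA -mulrDr ab1 mulr1.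
Qed.

Lemma sigma0_cover (R : idomainType) :
  \bigcup_(k in [set: macias R]) sigma0 k = setT.
Proof.
apply/seteqP; split=> // s _; exists point => //.
by apply/sigma0P; exists 1, 0; rewrite mul0r addr0 mul1r.
Qed.

Lemma sigma0_join (R : idomainType) (k l s : macias R) :
  [set: macias R] k -> [set: macias R] l -> sigma0 k s -> sigma0 l s ->
  exists m : macias R,
    [/\ [set: macias R] m, sigma0 m s & sigma0 m `<=` sigma0 k `&` sigma0 l].
Proof.
move=> _ _ /sigma0P[a [b ab1]] /sigma0P[c [d cd1]].
exists (Sub (val k * val l) (mulf_neq0 (valP k) (valP l))); split=> //.
  apply/sigma0P; exists (a * c), (a * val k * d + b); rewrite SubK.
  have -> : a * c * (val k * val l) = a * val k * (c * val l).
    by rewrite mulrACA.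
  by rewrite mulrDl addrA -[_ * d * _]mulrA -mulrDr cd1 mulr1.
move=> t /sigma0P[e [f]]; rewrite SubK => ef1.
split; apply/sigma0P.
  by exists (e * val l), f; rewrite -mulrA [val l * _]mulrC.
by exists (e * val k), f; rewrite -mulrA.
Qed.

HB.instance Definition _ (R : idomainType) :=
  isBaseTopological.Build (macias R) (@sigma0_cover R) (@sigma0_join R).

Lemma macias_openE (R : idomainType) :
  @open (macias R) = [set \bigcup_(k in K) sigma0 k | K in setT].
Proof.
by apply/seteqP; split=> A [K _ <-]; exists K.
Qed.

Definition macias_units (R : idomainType) : set (macias R) :=
  [set u | val u \is a GRing.unit].
Arguments macias_units : clear implicits.

(* Main.v *)
(** If [U(R)] is open, some basic set [sigma_k] around [1] lies in [U(R)]; then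
    [k] is in every maximal ideal [M]: otherwise [a k + m = 1] with [m] in [M],
    and either [m <> 0] is in [sigma_k], so that [M] contains a unit, or [m = 0]
    and [k] is a unit, so that [sigma_k] is all of [R^0] and [R] is a field.
    Conversely, if [k] is a nonzero element of the Jacobson radical, then
    [sigma_k] is exactly [U(R)], since every nonunit lies in a maximal ideal. *)
Require Import Defs.
From mathcomp Require Import all_boot all_order all_algebra.
From mathcomp Require Import boolp classical_sets topology.

Import GRing.Theory.
Local Open Scope classical_set_scope.
Local Open Scope ring_scope.

(** Bridges the library's boolean-predicate closure and [Prop]-valued classical sets; the middle
    clause is properness. *)
Lemma idealr_closedP {R : idomainType} {I : set R} :
  idealr_closed (mem I) <->
  [/\ I 0, ~ I 1 & forall a u v, I u -> I v -> I (a * u + v)].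
Proof.
split=> [[I0 I1 IM]|[I0 I1 IM]]; split.
- exact/set_mem.
- by move/mem_set; apply/negP.
- by move=> a u v /mem_set Iu /mem_set Iv; apply/set_mem/IM.
- exact/mem_set.
- by apply/negP => /set_mem.
- by move=> a u v /set_mem Iu /set_mem Iv; apply/mem_set/IM.
Qed.

Lemma idealr_closedM {R : idomainType} {I : set R} (a x : R) :
  idealr_closed (mem I) -> I x -> I (a * x).
Proof.
by move=> /idealr_closedP[I0 _ IM] Ix; rewrite -[a * x]addr0; apply: IM.
Qed.

Lemma idealr_closed_nonunit {R : idomainType} {I : set R} {x : R} :
  idealr_closed (mem I) -> I x -> x \isn't a GRing.unit.
Proof.
move=> II Ix; apply/negP => ux; have [_ + _] := idealr_closedP.1 II; apply.
by rewrite -(mulVr ux); apply: idealr_closedM.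
Qed.

Lemma idealr_closed_principal {R : idomainType} {s : R} :
  s \isn't a GRing.unit -> idealr_closed (mem (principal_ideal s)).
Proof.
move=> ns; apply/idealr_closedP; split.
- by exists 0 => //; rewrite mul0r.
- move=> [a _ as1]; move/negP: ns; apply; apply/unitrP.
  by exists a; rewrite [s * a]mulrC.
- move=> a _ _ [b _ <-] [c _ <-]; exists (a * b + c) => //.
  by rewrite mulrDl mulrA.
Qed.

(** Zorn's lemma on the proper ideals above [I]: a union of a chain omits 1 because each member
    does, and any two of its elements share a member because the chain is total. *)
Lemma idealr_closed_sub_maximal {R : idomainType} {I : set R} :
  idealr_closed (mem I) -> exists2 M, maximal_ideal M & I `<=` M.
Proof.
move=> II; have [I0 _ _] := idealr_closedP.1 II.
(* [P] must hold of [set0], the union of the empty chain. *)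
pose P (A : set R) := A !=set0 -> idealr_closed (mem A) /\ I `<=` A.
have [F FP Ftot|M [PM Mmax]] := @Zorn_bigcup R P.
  case=> x0 [X0 FX0 X0x0]; have [_ IX0] := FP _ FX0 (ex_intro _ _ X0x0).
  split; last by move=> x Ix; exists X0 => //; apply: IX0.
  apply/idealr_closedP; split.
  - by exists X0 => //; apply: IX0.
  - case=> X FX X1.
    by have [/idealr_closedP[_ + _] _] := FP _ FX (ex_intro _ _ X1).
  - move=> a u v [X FX Xu] [Y FY Yv].
    have [/idealr_closedP[_ _ XM] _] := FP _ FX (ex_intro _ _ Xu).
    have [/idealr_closedP[_ _ YM] _] := FP _ FY (ex_intro _ _ Yv).
    case: (Ftot _ _ FX FY) => XY.
    + by exists Y => //; apply: YM => //; apply: XY.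
    + by exists X => //; apply: XM => //; apply: XY.
(* An empty [M] would lie strictly below [I], which satisfies [P]. *)
have M0 : M !=set0.
  apply: contrapT => /set0P/negP; rewrite negbK => /eqP M0.
  apply: (Mmax I) => [|_]; last by split.
  by rewrite M0; split=> // /(_ _ I0).
have [MI IM] := PM M0; exists M => //; split=> // J JI MJ.
apply: contrapT => JM; apply: (Mmax J).
  by split=> // JsubM; apply: JM; apply/seteqP.
by split=> //; apply: subset_trans MJ.
Qed.

Lemma jacobson_radical0 {R : idomainType} : jacobson_radical R 0.
Proof. by move=> M [/idealr_closedP[]]. Qed.

(** Without such a relation, the sum of [M] and the ideal of [k] would be proper, hence equal to [M]
    by maximality, yet it contains [k]. *)
Lemma maximal_ideal_comaximal {R : idomainType} {M : set R} {k : R} :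
  maximal_ideal M -> ~ M k -> exists a m, M m /\ a * k + m = 1.
Proof.
move=> [MI Mmax] nMk; have [M0 _ MM] := idealr_closedP.1 MI.
apply: contrapT => nex.
pose J := ideal_add (principal_ideal k) M.
have JP x : J x <-> exists a m, M m /\ a * k + m = x.
  split=> [[_ [a _ <-] [m Mm <-]]|[a [m [Mm <-]]]]; first by exists a, m.
  by exists (a * k); [exists a | exists m].
have JM : J = M.
  apply: Mmax => [|x Mx]; last by apply/JP; exists 0, x; rewrite mul0r add0r.
  apply/idealr_closedP; split.
  - by apply/JP; exists 0, 0; rewrite mul0r add0r.
  (* Properness of [J] is exactly the assumption [nex]. *)
  - by move/JP.
  - move=> a _ _ /JP[b [m [Mm <-]]] /JP[c [n [Mn <-]]]; apply/JP.
    exists (a * b + c), (a * m + n); split; first exact: MM.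
    by rewrite mulrDl mulrDr mulrA addrACA.
by apply: nMk; rewrite -JM; apply/JP; exists 1, 0; rewrite mul1r addr0.
Qed.

(** Every basic set thus contains all units, so only its inclusion in the units is at stake. *)
Lemma sigma0_unit {R : idomainType} (k u : macias R) :
  val u \is a GRing.unit -> sigma0 k u.
Proof.
by move=> uu; apply/sigma0P; exists 0, (val u)^-1; rewrite mul0r add0r mulVr.
Qed.

Lemma sigma0_jacobson_radical {R : idomainType} (k : macias R) :
  jacobson_radical R (val k) -> sigma0 k = macias_units R.
Proof.
move=> Jk; apply/seteqP; split=> s; last exact: sigma0_unit.
move=> /sigma0P[a [b ab1]]; apply: contrapT => /negP ns.
(* This [M] contains both [s] and [k], hence also 1 = [a * val k + b * val s]. *)
have [M Mmax sM] := idealr_closed_sub_maximal (idealr_closed_principal ns).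
have [MI _] := Mmax; have [_ + MM] := idealr_closedP.1 MI; apply.
rewrite -ab1; apply: MM; first exact: Jk.
by apply: sM; exists b.
Qed.

Lemma jacobson_radical_sigma0 {R : idomainType} (k : macias R) :
  ~ GRing.field_axiom R -> sigma0 k `<=` macias_units R ->
  jacobson_radical R (val k).
Proof.
move=> nfR kU M Mmax; apply: contrapT => nMk.
have [a [m [Mm akm1]]] := maximal_ideal_comaximal Mmax nMk.
have [m0|m0] := eqVneq m 0.
  (* Here [a * val k = 1], so the coefficient 0 puts any nonzero [x] in [sigma0 k]. *)
  apply: nfR => x x0; apply: (kU (Sub x x0)); apply/sigma0P.
  by exists a, 0; rewrite mul0r -akm1 m0.
have /negP := idealr_closed_nonunit Mmax.1 Mm; apply.
by apply: (kU (Sub m m0)); apply/sigma0P; exists a, 1; rewrite mul1r.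
Qed.

Lemma open_macias_unitsP {R : idomainType} :
  ~ GRing.field_axiom R ->
  open (macias_units R) <-> exists2 k, k != 0 & jacobson_radical R k.
Proof.
move=> nfR; rewrite macias_openE; split=> [[K _ KU]|[k k0 Jk]].
  (* The unit 1 selects a basic set from the union indexed by [K]. *)
  have : macias_units R (Sub 1 (oner_neq0 R)).
    by rewrite /macias_units /= unitr1.
  rewrite -KU => -[k Kk _]; have kU : sigma0 k `<=` macias_units R.
    by move=> s ks; rewrite -KU; exists k.
  by exists (\val k); [exact: (valP k) | exact: jacobson_radical_sigma0 nfR kU].
(* A single basic set already gives all the units. *)
exists [set Sub k k0] => //; rewrite bigcup_set1.
exact: sigma0_jacobson_radical.
Qed.

Theorem theorem3p3 (R : idomainType) (nfR : ~ GRing.field_axiom R) :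
  semiprimitive R <-> ~ open (macias_units R).
Proof.
rewrite (open_macias_unitsP nfR); split=> [J0 [k /eqP k0]|nJ].
  by rewrite J0.
apply/seteqP; split=> [k Jk|_ ->]; last exact: jacobson_radical0.
by apply: contrapT => /eqP k0; apply: nJ; exists k.
Qed.
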